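(* Let $b,e$ be integers with $b\ge 2$ and $1\le e<b$. For any finite graph $G$: every handle $P(n)$ in $G$ with $n\ge \mathsf{Even}(2b/e)$ is $(2b+e,b)$-reducible in $G$, and every parity handle $PP(n)$ in $G$ with $n\ge 2$ is $(2b+e,b)$-reducible in $G$.
   Context: For positive integers $a,b$, an $(a,b)$-coloring of a graph assigns to each vertex a $b$-element subset of $\{1,\ldots,a\}$ so that adjacent vertices receive disjoint subsets. For a real $x$, $\mathsf{Even}(x)$ is the least even integer $m$ with $m\ge x$. A handle $P(n)$ of length $n$ in $G$ is a path of length $n$ which is an induced subgraph of $G$ and whose vertices of degree 2 in the path have degree 2 in $G$; its interior $\mathrm{int}(P(n))$ is the set of its vertices of degree 2 in the path. A parity handle $PP(n)$ is a handle $P(n)$ such that there exists another path of length $m\le n$ with $m\equiv n\pmod 2$ in $G-\mathrm{int}(P(n))$ between the two end-vertices of $P(n)$. A handle $H$ is $(a,b)$-reducible in $G$ if every $(a,b)$-coloring of $G-\mathrm{int}(H)$ extends to an $(a,b)$-coloring of $G$. *)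

(* Defs.v *)
From HB Require Import structures.
From mathcomp Require Import all_boot all_order all_algebra.
Set Implicit Arguments.
Unset Strict Implicit.
Unset Printing Implicit Defensive.
Import Order.TTheory GRing.Theory Num.Theory.

Record sgraph := SGraph {
  vertex :> finType;
  adj : rel vertex;
  adj_sym : symmetric adj;
  adj_irr : irreflexive adj
}.

Definition degree (G : sgraph) (v : G) : nat := #|[set w | adj v w]|.

Section Delete.
Variables (G : sgraph) (X : {set G}).

Definition delete_adj : rel {v : G | v \notin X} :=
  fun u v => adj (val u) (val v).

Lemma delete_adj_sym : symmetric delete_adj.
Proof. by move=> u v; apply: adj_sym. Qed.

Lemma delete_adj_irr : irreflexive delete_adj.
Proof. by move=> u; apply: adj_irr. Qed.

Definition delete : sgraph := SGraph delete_adj_sym delete_adj_irr.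
End Delete.

(* The colors 1, ..., a are represented by the elements of 'I_a. *)
Definition coloring (a b : nat) (G : sgraph) (c : G -> {set 'I_a}) : Prop :=
  (forall v : G, #|c v| = b) /\
  (forall u v : G, adj u v -> [disjoint c u & c v]).

(* A path of length n is given by its n.+1 vertices p 0, ..., p n, listed in
   order from one end. *)
Definition is_path (G : sgraph) (n : nat) (p : 'I_n.+1 -> G) : Prop :=
  injective p /\ (forall i j : 'I_n.+1, j = i.+1 :> nat -> adj (p i) (p j)).

(* Adjacency in the path p itself, regarded as a subgraph of G. *)
Definition path_adj (G : sgraph) (n : nat) (p : 'I_n.+1 -> G) : rel G :=
  fun u v => [exists i : 'I_n.+1, exists j : 'I_n.+1,
    [&& p i == u, p j == v & (j == i.+1 :> nat) || (i == j.+1 :> nat)]].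

Definition interior (G : sgraph) (n : nat) (p : 'I_n.+1 -> G) : {set G} :=
  [set v | #|[set w | path_adj p v w]| == 2].

Definition handle (G : sgraph) (n : nat) (p : 'I_n.+1 -> G) : Prop :=
  [/\ is_path p,
      forall i j : 'I_n.+1, adj (p i) (p j) = path_adj p (p i) (p j)
    & forall v : G, v \in interior p -> degree v = 2].

(* The last condition says that q is not p itself; for n >= 2 it is automatic,
   since q avoids the nonempty interior of p. *)
Definition parity_handle (G : sgraph) (n : nat) (p : 'I_n.+1 -> G) : Prop :=
  handle p /\
  exists (m : nat) (q : 'I_m.+1 -> delete (interior p)),
    [/\ m <= n, m = n %[mod 2], is_path q,
        val (q ord0) = p ord0 /\ val (q ord_max) = p ord_max
      & codom (fun i => val (q i)) <> codom p].

Definition reducible (a b : nat) (G : sgraph) (n : nat) (p : 'I_n.+1 -> G) :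
    Prop :=
  forall c : delete (interior p) -> {set 'I_a}, coloring b c ->
  exists c' : G -> {set 'I_a},
    coloring b c' /\ (forall v : delete (interior p), c' (val v) = c v).

Local Open Scope ring_scope.

Definition is_least_even (R : archiRealFieldType) (x : R) (m : int) : Prop :=
  [/\ (2 %| m)%Z, x <= m%:~R
    & forall k : int, (2 %| k)%Z -> x <= k%:~R -> m <= k].

Lemma least_even_exists (R : archiRealFieldType) (x : R) :
  {m : int | is_least_even x m}.
Proof.
exists (Num.ceil (x / 2) * 2); split.
- exact: dvdz_mull.
- by rewrite intrM -ler_pdivrMr ?ltr0n // Num.Theory.ceil_ge.
- move=> k /dvdzP[l ->]; rewrite intrM -ler_pdivrMr ?ltr0n // => hx.
  by rewrite ler_pM2r // ceil_le_int.
Qed.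

Definition Even (R : archiRealFieldType) (x : R) : int :=
  sval (least_even_exists x).

(* Main.v *)
Require Import Defs.
From HB Require Import structures.
From mathcomp Require Import all_boot all_order all_algebra.
From mathcomp Require Import zify.
Set Implicit Arguments.
Unset Strict Implicit.
Unset Printing Implicit Defensive.
Import GRing.Theory Num.Theory.

(** Colouring the interior of a handle amounts to finding a walk of given
    length between two vertices of the Kneser graph of [b]-subsets of
    [2b+e] colours. Two steps of a walk can exchange up to [e] elements of a
    set, so a walk of length [2k] joins [A] to [B] as soon as
    [#|A :\: B| <= k * e]; for odd lengths one first steps from [A] to a set
    containing [B :\: A]. For a parity handle, the colours along the other path
    already form a walk, which is lengthened by going back and forth. *)

Lemma subset_with_card (T : finType) (A : {set T}) (k : nat) :
  k <= #|A| -> exists2 B : {set T}, B \subset A & #|B| = k.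
Proof.
move=> kA; exists [set x in take k (enum A)].
  by apply/subsetP=> x; rewrite inE => /mem_take; rewrite mem_enum.
rewrite cardsE (card_uniqP _) ?take_uniq ?enum_uniq // size_takel //.
by rewrite -cardE.
Qed.

Lemma superset_with_card (T : finType) (A B : {set T}) (k : nat) :
  A \subset B -> #|A| <= k <= #|B| ->
  exists C : {set T}, [/\ A \subset C, C \subset B & #|C| = k].
Proof.
move=> sAB /andP[Ak kB].
have [D] : exists2 D : {set T}, D \subset B :\: A & #|D| = k - #|A|.
  by apply: subset_with_card; rewrite cardsDS // leq_sub2r.
rewrite subsetD => /andP[sDB dDA] cD; exists (A :|: D).
rewrite subsetUl subUset sAB sDB; split=> //.
by rewrite cardsU disjoint_setI0 1?disjoint_sym // cards0 subn0 cD subnKC.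
Qed.

(** The walk is a total function on [nat], free beyond index [n], so that prepending a set is a mere
    shift of indices. *)
Definition kneser_walk (T : finType) (b n : nat) (A B : {set T}) : Prop :=
  exists s : nat -> {set T},
    [/\ s 0 = A, s n = B, forall i, i <= n -> #|s i| = b
      & forall i, i < n -> [disjoint s i & s i.+1]].

(** * Walks in the Kneser graph *)

Section KneserWalk.
Variables (T : finType) (b e : nat).
Hypothesis cardT : #|T| = 2 * b + e.
Implicit Types A B C : {set T}.

Lemma kneser_walk0 A : #|A| = b -> kneser_walk b 0 A A.
Proof. by move=> cA; exists (fun=> A). Qed.

Lemma kneser_walk_cons n A B C :
  #|A| = b -> [disjoint A & C] -> kneser_walk b n C B ->
  kneser_walk b n.+1 A B.
Proof.
move=> cA dAC [s [s0 sn cs ds]].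
exists (fun i => if i is j.+1 then s j else A); split=> //.
  by case=> [|i] // /cs.
by case=> [|i]; [rewrite s0 | apply: ds].
Qed.

Lemma exists_disjoint_card A :
  #|A| <= b + e -> exists2 C : {set T}, [disjoint A & C] & #|C| = b.
Proof.
move=> cA; have [|C sC cC] := @subset_with_card _ (~: A) b.
  by rewrite cardsCs setCK cardT; lia.
by exists C; rewrite // disjoint_sym disjoints_subset.
Qed.

(** The detour from [A] to a disjoint [C] and back is prepended [k] times. *)
Lemma kneser_walk_lengthen n k A B :
  kneser_walk b n A B -> kneser_walk b (n + k.*2) A B.
Proof.
move=> w; have cA : #|A| = b by case: w => s [<- _ cs _]; apply: cs.
have [|C dAC cC] := @exists_disjoint_card A; first by rewrite cA leq_addr.
elim: k => [|k IHk]; first by rewrite addn0.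
rewrite doubleS !addnS; apply: (kneser_walk_cons cA dAC).
by apply: kneser_walk_cons IHk; rewrite // disjoint_sym.
Qed.

Lemma kneser_walk_even k A B :
  #|A| = b -> #|B| = b -> #|A :\: B| <= k * e -> kneser_walk b k.*2 A B.
Proof.
move=> + cB; elim: k A => [|k IHk] A cA cAB.
  have /eqP-> : A == B.
    rewrite eqEcard cA cB leqnn andbT -setD_eq0 -cards_eq0.
    by move: cAB; rewrite mul0n leqn0.
  exact: kneser_walk0.
(* Two steps trade [t] elements [E] of [A :\: B] for [t] elements [D] of [B :\: A]. The middle set
   [C] must avoid both [A] and [A'], hence is taken disjoint from [A :|: D]; this is possible
   because [b + t <= b + e]. *)
pose t := minn e #|A :\: B|.
have eqD : #|B :\: A| = #|A :\: B| by rewrite !cardsD setIC cA cB.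
have [|D sD cD] := @subset_with_card _ (B :\: A) t.
  by rewrite eqD geq_minr.
have [|E sE cE] := @subset_with_card _ (A :\: B) t.
  by rewrite geq_minr.
move: (sD) (sE); rewrite !subsetD => /andP[sDB dDA] /andP[sEA dEB].
have cAD : #|A :|: D| = b + t.
  by rewrite cardsU disjoint_setI0 1?disjoint_sym // cards0 subn0 cA cD.
pose A' := (A :|: D) :\: E.
have cA' : #|A'| = b.
  by rewrite cardsDS ?(subset_trans sEA) ?subsetUl // cAD cE addnK.
have [|C dC cC] := @exists_disjoint_card (A :|: D).
  by rewrite cAD leq_add2l geq_minl.
rewrite doubleS; apply: (@kneser_walk_cons _ _ _ C) => //.
  exact: disjointWl (subsetUl _ _) dC.
apply: (@kneser_walk_cons _ _ _ A') => //.
  rewrite disjoint_sym; exact: disjointWl (subsetDl _ _) dC.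
apply: IHk => //.
have -> : A' :\: B = (A :\: B) :\: E.
  rewrite /A' setDDl [E :|: B]setUC -setDDl setDUl.
  rewrite (_ : D :\: B = set0) ?setU0 //.
  by apply/eqP; rewrite setD_eq0.
(* Either [t = e] and the difference drops by [e], or [t] exhausts it. *)
by rewrite cardsDS // cE /t; lia.
Qed.

Lemma kneser_walk_long n A B :
  #|A| = b -> #|B| = b -> b <= n./2 * e -> kneser_walk b n A B.
Proof.
move=> cA cB bn; rewrite -[n]odd_double_half; case: (odd n); last first.
  apply: kneser_walk_even => //; apply: leq_trans bn.
  by rewrite -cA subset_leq_card ?subsetDl.
(* For odd [n], the extra step goes to a [C] inside the complement of [A], which has [b + e]
   elements; [n./2] double steps remain to reach [B]. *)
have [||C [sBC sCA cC]] := @superset_with_card _ (B :\: A) (~: A) b.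
- by rewrite setDE subsetIr.
- rewrite -{1}cB subset_leq_card ?subsetDl //= cardsCs setCK cardT cA; lia.
apply: (@kneser_walk_cons _ _ _ C) => //.
  by rewrite disjoint_sym disjoints_subset.
apply: kneser_walk_even => //; apply: leq_trans bn.
by rewrite -cC subset_leq_card ?subsetDl.
Qed.

End KneserWalk.

(** * Handles and the extension of colourings to their interior *)

Definition kept_vertex (G : sgraph) (X : {set G}) (v : G) (vX : v \notin X) :
  delete X := exist (fun u => u \notin X) v vX.

Section Handle.
Variables (G : sgraph) (n : nat) (p : 'I_n.+1 -> G).

Lemma path_adj_sym : symmetric (path_adj p).
Proof.
move=> u v; apply/existsP/existsP=> -[i /existsP[j /and3P[pi pj ij]]];
  by exists j; apply/existsP; exists i; rewrite pi pj orbC.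
Qed.

Lemma path_adjE (i j : 'I_n.+1) : injective p ->
  path_adj p (p i) (p j) = (j == i.+1 :> nat) || (i == j.+1 :> nat).
Proof.
move=> pI; apply/existsP/idP=> [[i' /existsP[j' /and3P[]]]|ij].
  by move=> /eqP/pI-> /eqP/pI->.
by exists i; apply/existsP; exists j; rewrite !eqxx.
Qed.

Lemma path_adjP (u v : G) :
  reflect (exists i j : 'I_n.+1,
             [/\ u = p i, v = p j & (j == i.+1 :> nat) || (i == j.+1 :> nat)])
          (path_adj p u v).
Proof.
apply: (iffP existsP) => [[i /existsP[j /and3P[/eqP<- /eqP<- ij]]]|].
  by exists i, j.
by move=> [i [j [-> -> ij]]]; exists i; apply/existsP; exists j; rewrite !eqxx.
Qed.

(** Passes from degrees in the path to positions: an end has at most one neighbour in the path, any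
    other vertex exactly two. *)
Lemma mem_interior (i : 'I_n.+1) :
  injective p -> (p i \in interior p) = (0 < i < n).
Proof.
move=> pI; rewrite inE.
have nbr (w : G) : path_adj p (p i) w ->
    exists2 j : 'I_n.+1, w = p j & (j == i.+1 :> nat) || (i == j.+1 :> nat).
  by case/path_adjP=> i' [j [/pI<- -> ij]]; exists j.
apply/eqP/andP=> [c2|[i0 ilt]].
  have [i0|i0] := posnP i.
    (* For [n = 0] the index [inord 1] is a default value, but then there are no neighbours at
       all. *)
    have : [set w | path_adj p (p i) w] \subset [set p (inord 1)].
      apply/subsetP=> w; rewrite !inE => /nbr[j -> ij]; apply/eqP; congr p.
      apply: val_inj; rewrite /= inordK; have := ltn_ord j; lia.
    by move/subset_leq_card; rewrite c2 cards1.
  split=> //; rewrite ltnNge; apply/negP=> ni.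
  have : [set w | path_adj p (p i) w] \subset [set p (inord n.-1)].
    apply/subsetP=> w; rewrite !inE => /nbr[j -> ij]; apply/eqP; congr p.
    apply: val_inj; rewrite /= inordK;
      have := ltn_ord j; have := ltn_ord i; lia.
  by move/subset_leq_card; rewrite c2 cards1.
have -> : [set w | path_adj p (p i) w] = [set p (inord i.-1); p (inord i.+1)].
  apply/setP=> w; rewrite !inE; apply/idP/orP=> [/nbr[j -> /orP[]/eqP ij]|].
  - by right; rewrite -ij inord_val.
  - by left; rewrite ij /= inord_val.
  - by case=> /eqP->; rewrite path_adjE // !inordK; lia.
rewrite cards2 (_ : _ != _) //; apply/eqP=> /pI/(congr1 val) /=.
by rewrite !inordK; lia.
Qed.

(** The neighbours of [v] in the path are among those in [G], and both sets have two elements, so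
    they coincide. *)
Lemma handle_interior_adj (v w : G) :
  handle p -> v \in interior p -> adj v w = path_adj p v w.
Proof.
move=> [[pI pA] _ deg2] vint; have := deg2 v vint; rewrite /degree => dv.
have : [set w | path_adj p v w] == [set w | adj v w].
  rewrite eqEcard dv; move: (vint); rewrite inE => /eqP->; rewrite andbT.
  apply/subsetP=> x; rewrite !inE => /path_adjP[i [j [-> -> /orP[]/eqP ij]]].
    exact: pA.
  by rewrite adj_sym; apply: pA.
by move/eqP/setP/(_ w); rewrite !inE.
Qed.

Lemma handle_end_notin_interior :
  handle p -> p ord0 \notin interior p /\ p ord_max \notin interior p.
Proof. by case=> -[pI _] _ _; rewrite !mem_interior //= ltnn andbF. Qed.

(** The walk colours the path vertex by vertex and agrees with [c] at the ends. Every edge meeting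
    the interior is an edge of the path, and all others lie in the deleted graph, where [c] is
    already proper. *)
Lemma reducible_of_kneser_walk (a b : nat) : handle p ->
  (forall (c : delete (interior p) -> {set 'I_a}) (x y : delete (interior p)),
     coloring b c -> val x = p ord0 -> val y = p ord_max ->
     kneser_walk b n (c x) (c y)) ->
  reducible a b p.
Proof.
move=> hp walk c cc; have [[pI pA] _ _] := hp.
have [e0 en] := handle_end_notin_interior hp.
have [s [s0 sn cs ds]] :=
  walk c (kept_vertex e0) (kept_vertex en) cc (erefl _) (erefl _).
(* The default [set0] is never reached, since a vertex that is not kept lies on the path. *)
pose c' (v : G) := if insub v is Some u then c u
                   else if [pick i | p i == v] is Some i then s i else set0.
have c'in (v : delete (interior p)) : c' (val v) = c v by rewrite /c' valK.
have c'p (i : 'I_n.+1) : c' (p i) = s i.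
  have [iint|] := boolP (p i \in interior p).
    rewrite /c' insubN ?iint //; case: pickP => [j /eqP/pI-> //|/(_ i)].
    by rewrite eqxx.
  rewrite mem_interior // => ij.
  have [i0|i0] := posnP i.
    have -> : i = ord0 by apply: val_inj.
    by rewrite s0 -c'in.
  have -> : i = ord_max by apply: val_inj => /=; have := ltn_ord i; lia.
  by rewrite sn -c'in.
have c'path u v : path_adj p u v -> [disjoint c' u & c' v].
  case/path_adjP=> i [j [-> -> /orP[]/eqP ij]]; rewrite !c'p ij.
    by apply: ds; rewrite -ltnS -ij ltn_ord.
  by rewrite disjoint_sym; apply: ds; rewrite -ltnS -ij ltn_ord.
exists c'; split=> //; split=> [v|u v uv].
  have [vint|vint] := boolP (v \in interior p); last first.
    by rewrite -[v]/(val (kept_vertex vint)) c'in; case: cc.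
  (* Having a neighbour in the path shows that [v] is some [p i]. *)
  have : [set w | path_adj p v w] != set0.
    by rewrite -card_gt0; move: vint; rewrite inE => /eqP->.
  case/set0Pn=> w; rewrite inE => /path_adjP[i [_ [-> _ _]]].
  by rewrite c'p cs // -ltnS ltn_ord.
have [uint|uint] := boolP (u \in interior p).
  by apply: c'path; rewrite -handle_interior_adj.
have [vint|vint] := boolP (v \in interior p).
  by apply: c'path; rewrite path_adj_sym -handle_interior_adj // adj_sym.
rewrite -[u]/(val (kept_vertex uint)).
rewrite -[v]/(val (kept_vertex vint)) !c'in.
by case: cc => _; apply.
Qed.

End Handle.

(** A colouring is a homomorphism to the Kneser graph, so it maps paths to walks. *)
Lemma kneser_walk_of_path (G : sgraph) (a b m : nat) (c : G -> {set 'I_a})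
    (q : 'I_m.+1 -> G) :
  coloring b c -> is_path q -> kneser_walk b m (c (q ord0)) (c (q ord_max)).
Proof.
move=> [cc dc] [_ qA]; exists (fun i => c (q (inord i))); split=> //.
- by congr (c (q _)); apply: val_inj; rewrite /= inordK.
- by congr (c (q _)); apply: val_inj; rewrite /= inordK.
- by move=> i im; apply/dc/qA; rewrite !inordK // ltnW.
Qed.

(** Writing the even bound as [l * 2], one gets [l <= n./2] from [n] and [b <= l * e] from clearing
    the denominator. *)
Lemma Even_le_half (b e n : nat) : 0 < e ->
  (Even (2 * b%:R / e%:R : rat) <= n%:Z)%R -> b <= n./2 * e.
Proof.
rewrite /Even; case: least_even_exists => m /= [m2 xm _] e0 mn.
case/dvdzP: m2 => l lm; rewrite {m}lm in xm mn.
have {mn} ln : (l <= (n./2)%:Z)%R by lia.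
move: xm; rewrite intrM ler_pdivrMr ?ltr0n // => xm.
have : (2 * b%:Z <= l * 2 * e%:Z)%R.
  by rewrite -(ler_int rat) !intrM.
nia.
Qed.

Theorem theorem2 (b e : nat) (hb : (2 <= b)%N) (he : (1 <= e < b)%N)
    (G : sgraph) :
  (forall (n : nat) (p : 'I_n.+1 -> G), handle p ->
     (Even (2 * b%:R / e%:R : rat) <= n%:Z)%R ->
     reducible (2 * b + e) b p) /\
  (forall (n : nat) (p : 'I_n.+1 -> G), parity_handle p ->
     (2 <= n)%N ->
     reducible (2 * b + e) b p).
Proof.
split=> n p.
  have e0 : 0 < e by case/andP: he.
  move=> hp /(Even_le_half e0) bn.
  apply: reducible_of_kneser_walk => // c x y [cc _] _ _.
  by apply: (kneser_walk_long (card_ord _)).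
move=> [hp [m [q [mn mnmod qP [q0 qm] _]]]] _.
apply: reducible_of_kneser_walk => // c x y cc x0 ym.
have -> : x = q ord0 by apply: val_inj; rewrite q0.
have -> : y = q ord_max by apply: val_inj; rewrite qm.
(* Equal parity makes [n - m] even, so back-and-forth detours fill the gap exactly. *)
have -> : n = m + (n - m)./2.*2 by lia.
exact: (kneser_walk_lengthen (card_ord _) _ (kneser_walk_of_path cc qP)).
Qed.
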